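(* Every locally Gabriel graph on a set of $n$ points in the plane in convex position has at most $2n\log n+O(n)$ edges.
   Context: $\log$ denotes the binary logarithm. A geometric graph $G=(P,E)$ on a finite planar point set $P$ is a locally Gabriel graph if for every edge $(u,v)\in E$, the disk with diameter $\overline{uv}$ contains no neighbour in $G$ of $u$ or of $v$ (other than $u$ and $v$ themselves). Points are in convex position if each of them is a vertex of the convex hull of the set. *)

(* Defs.v *)
From HB Require Import structures.
From mathcomp Require Import all_boot all_order all_algebra.
From mathcomp Require Import all_classical all_reals all_analysis.
Set Implicit Arguments. Unset Strict Implicit. Unset Printing Implicit Defensive.
Import Order.TTheory GRing.Theory Num.Theory.
Local Open Scope ring_scope.

Definition log2 (R : realType) (x : R) : R := ln x / ln 2.

Definition sqdist (R : realType) (a b : R * R) : R :=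
  (a.1 - b.1) ^+ 2 + (a.2 - b.2) ^+ 2.

(* w lies in the closed disk with diameter segment uv:
   |w - m| <= |u - v| / 2 where m is the midpoint of uv (squared form). *)
Definition in_diam_disk (R : realType) (u v w : R * R) : bool :=
  sqdist w ((u.1 + v.1) / 2, (u.2 + v.2) / 2) <= sqdist u v / 4.

Definition in_hull_of_others (R : realType) (n : nat) (p : 'I_n -> R * R)
  (i : 'I_n) : Prop :=
  exists lam : 'I_n -> R,
    [/\ forall j, 0 <= lam j, lam i = 0, \sum_j lam j = 1,
        \sum_j lam j * (p j).1 = (p i).1 & \sum_j lam j * (p j).2 = (p i).2].

Definition convex_position (R : realType) (n : nat) (p : 'I_n -> R * R) : Prop :=
  forall i, ~ in_hull_of_others p i.

Definition simple_graph (n : nat) (adj : rel 'I_n) : Prop :=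
  (forall u v, adj u v = adj v u) /\ (forall u, ~~ adj u u).

Definition locally_gabriel (R : realType) (n : nat) (p : 'I_n -> R * R)
  (adj : rel 'I_n) : Prop :=
  forall u v, adj u v -> forall w, w != u -> w != v ->
    adj u w || adj v w -> ~~ in_diam_disk (p u) (p v) (p w).

Definition num_edges (n : nat) (adj : rel 'I_n) : nat :=
  #|[set e : 'I_n * 'I_n | (e.1 < e.2)%N && adj e.1 e.2]|.

(* Main.v *)
(** If two edges uv, uw share an endpoint, the triangle uvw has acute angles at
    v and w. Hence, if bc, ac and bd are edges, the convex quadrilateral on
    a, b, c, d has acute angles at b and c, so that its sides ba and cd diverge
    as they leave bc.

    Cut the polygon at its lexicographically extreme vertices into two chains,
    and attach to each vertex the direction of the side leaving it. Let X and Y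
    be sets of vertices such that every direction of X precedes every direction
    of Y. For b, a on the lower chain in X and c, d on the upper chain in Y the
    directions of ba and cd are then known to be ordered, and this excludes the
    configuration above: every edge bc between the two sets is extreme among
    the edges at b or among those at c, so there are only linearly many. The
    same holds with the chains exchanged, and for the edges inside one chain.
    Halving the vertices by direction gives E(2m) <= 2 E(m) + 2m for the edges
    between the chains, hence at most n log n + O(n) edges. *)
Require Import Defs.
From HB Require Import structures.
From mathcomp Require Import all_boot all_order all_algebra.
From mathcomp Require Import all_classical all_reals all_analysis.
From mathcomp Require Import ring lra zify.
Import Order.TTheory GRing.Theory Num.Theory.
Local Open Scope ring_scope.
Set Implicit Arguments.
Unset Strict Implicit.
Unset Printing Implicit Defensive.

(** * Plane vectors: cross and dot products, and the order of directions in a half-plane *)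

Definition vec (R : realType) (a b : R * R) : R * R := (b.1 - a.1, b.2 - a.2).

Definition cross (R : realType) (u v : R * R) : R := u.1 * v.2 - u.2 * v.1.

Definition dot (R : realType) (u v : R * R) : R := u.1 * v.1 + u.2 * v.2.

Definition orient (R : realType) (a b c : R * R) : R :=
  cross (vec a b) (vec a c).

(* A half-plane containing exactly one of u, -u for every nonzero u; on it the
   sign of the cross product is a total preorder by direction. *)
Definition lexpos (R : realType) (u : R * R) : bool :=
  (0 < u.1) || ((u.1 == 0) && (0 < u.2)).

Section PlaneVectors.
Variable R : realType.
Implicit Types (u v w a b c d : R * R).

Lemma lexposP u : lexpos u -> 0 < u.1 \/ (u.1 = 0 /\ 0 < u.2).
Proof. by rewrite /lexpos => /orP[|/andP[/eqP]]; [left|right]. Qed.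

Lemma lexpos_total a b : a != b -> lexpos (vec a b) || lexpos (vec b a).
Proof.
case: a b => [a1 a2] [b1 b2]; rewrite xpair_eqE negb_and /lexpos /= !subr_gt0.
rewrite !subr_eq0 (eq_sym b1).
by case: (ltgtP a1 b1) => //= _; rewrite neq_lt.
Qed.

Lemma lexpos_asym a b : lexpos (vec a b) -> ~~ lexpos (vec b a).
Proof.
move=> /lexposP ab; apply/negP => /lexposP ba; move: ab ba; rewrite /vec /=.
by case=> [?|[? ?]] [?|[? ?]]; lra.
Qed.

(** For [v.1 > 0] this follows from [v.1 (u x w) = u.1 (v x w) + w.1 (u x v)]. A vertical [v] is the
    last direction of the half-plane and forces [w] to be vertical as well. *)
Lemma cross_trans v u w : lexpos u -> lexpos v -> lexpos w ->
  0 <= cross u v -> 0 <= cross v w -> 0 <= cross u w.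
Proof.
case: u v w => [u1 u2] [v1 v2] [w1 w2].
move=> /lexposP /= Hu /lexposP /= Hv /lexposP /= Hw; rewrite /cross /= => uv vw.
case: Hv => [v_gt0|[v0 v_gt0]].
  rewrite -(pmulr_rge0 _ v_gt0).
  have -> : v1 * (u1 * w2 - u2 * w1) =
    u1 * (v1 * w2 - v2 * w1) + w1 * (u1 * v2 - u2 * v1) by ring.
  by apply: addr_ge0; apply: mulr_ge0 => //; lra.
subst v1.
have w0 : w1 = 0 by case: Hw => [w_gt0|[]//]; have := mulr_gt0 v_gt0 w_gt0; lra.
case: Hw => [|[_ w_gt0]]; first by rewrite w0 ltxx.
by rewrite w0 mulr0 subr0; apply: mulr_ge0; lra.
Qed.

Lemma cross_trans_lt v u w : lexpos u -> lexpos v -> lexpos w ->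
  0 < cross u v -> 0 < cross v w -> 0 < cross u w.
Proof.
case: u v w => [u1 u2] [v1 v2] [w1 w2].
move=> /lexposP /= Hu /lexposP /= Hv /lexposP /= Hw; rewrite /cross /= => uv vw.
(* Nothing in the half-plane comes strictly after a vertical [v]. *)
case: Hv => [v_gt0|[v0 v_gt0]]; last first.
  by subst v1; exfalso; case: Hw => [|[]] *; subst; nra.
have u_gt0 : 0 < u1 by case: Hu => [//|[u0 ?]]; subst u1; nra.
rewrite -(pmulr_rgt0 _ v_gt0).
have -> : v1 * (u1 * w2 - u2 * w1) =
  u1 * (v1 * w2 - v2 * w1) + w1 * (u1 * v2 - u2 * v1) by ring.
apply: ltr_pwDl; first exact: mulr_gt0.
by apply: mulr_ge0; lra.
Qed.

Lemma lexpos_parallel_dot_ge0 u v :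
  lexpos u -> lexpos v -> cross u v = 0 -> 0 <= dot u v.
Proof.
case: u v => [u1 u2] [v1 v2] /lexposP /= Hu /lexposP /= Hv.
rewrite /cross /dot /= => uv.
case: Hu => [u_gt0|[u0 u_gt0]]; case: Hv => [v_gt0|[v0 v_gt0]]; subst; try nra.
rewrite -(pmulr_rge0 _ u_gt0).
have -> : u1 * (u1 * v1 + u2 * v2) =
  v1 * (u1 * u1 + u2 * u2) + u2 * (u1 * v2 - u2 * v1) by ring.
by rewrite uv mulr0 addr0; nra.
Qed.

(* Both lemmas follow from
   |w|^2 (p x q) = (p . w) (w x q) - (w x p) (q . w). *)
Lemma acute_cw_cross_lt0 p q w : 0 < dot p w -> dot q w < 0 ->
  0 < cross p w -> 0 < cross q w -> cross p q < 0.
Proof.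
move=> pw qw cpw cqw.
have w_gt0 : 0 <= dot w w by rewrite addr_ge0 // -expr2 sqr_ge0.
have E : dot w w * cross p q = - (dot p w * cross q w) + cross p w * dot q w.
  by rewrite /dot /cross; ring.
rewrite ltNge; apply/negP => pq.
have : 0 <= dot w w * cross p q by apply: mulr_ge0.
by rewrite E; nra.
Qed.

Lemma acute_ccw_cross_gt0 p q w : 0 < dot p w -> dot q w < 0 ->
  cross p w < 0 -> cross q w < 0 -> 0 < cross p q.
Proof.
move=> pw qw cpw cqw.
have w_gt0 : 0 <= dot w w by rewrite addr_ge0 // -expr2 sqr_ge0.
have E : dot w w * cross p q = - (dot p w * cross q w) + cross p w * dot q w.
  by rewrite /dot /cross; ring.
rewrite ltNge; apply/negP => pq.
have : dot w w * cross p q <= 0 by apply: mulr_ge0_le0.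
by rewrite E; nra.
Qed.

(** Thales: a point is in the closed disk exactly when it does not see the diameter under an acute
    angle. *)
Lemma in_diam_diskE u v w : in_diam_disk u v w = (dot (vec w u) (vec w v) <= 0).
Proof.
rewrite /in_diam_disk /sqdist /dot /vec /=.
by apply/idP/idP => H; lra.
Qed.

End PlaneVectors.

(** * Configurations excluded by convex position *)

Section ConvexPosition.
Variables (R : realType) (n : nat) (p : 'I_n -> R * R).
Hypothesis p_conv : convex_position p.

(** Dividing the weights by their sum gives a convex combination. The indices [x], [y], [z] may
    coincide, since their indicator weights add up; the collinear case relies on this. *)
Lemma convex_position_no_combination (x y z w : 'I_n) (al be ga : R) :
  w != x -> w != y -> w != z ->
  0 <= al -> 0 <= be -> 0 <= ga -> 0 < al + be + ga ->
  al * (vec (p w) (p x)).1 + be * (vec (p w) (p y)).1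
    + ga * (vec (p w) (p z)).1 = 0 ->
  al * (vec (p w) (p x)).2 + be * (vec (p w) (p y)).2
    + ga * (vec (p w) (p z)).2 = 0 -> False.
Proof.
move=> wx wy wz al0 be0 ga0 S0 E1 E2; apply: (@p_conv w).
pose D (i j : 'I_n) : R := (j == i)%:R.
have sumD i (F : 'I_n -> R) : \sum_j D i j * F j = F i.
  rewrite (bigD1 i) //= /D eqxx mul1r big1 ?addr0 // => j /negPf ->.
  by rewrite mul0r.
have comb (F : 'I_n -> R) :
    \sum_j (al * D x j + be * D y j + ga * D z j) / (al + be + ga) * F j
    = (al * F x + be * F y + ga * F z) / (al + be + ga).
  rewrite -(sumD x F) -(sumD y F) -(sumD z F) !mulr_sumr -!big_split mulr_suml.
  by apply: eq_bigr => j _ /=; ring.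
exists (fun j => (al * D x j + be * D y j + ga * D z j) / (al + be + ga)).
have S1 : al + be + ga != 0 by rewrite gt_eqF.
split.
- move=> j; apply: divr_ge0; last exact: ltW.
  by rewrite !addr_ge0 // mulr_ge0 // ler0n.
- by rewrite /D (negPf wx) (negPf wy) (negPf wz) !mulr0 !addr0 mul0r.
- have := comb (fun=> 1); under eq_bigr do rewrite mulr1.
  by move=> ->; rewrite !mulr1 divff.
- rewrite comb; apply: (mulIf S1); rewrite divfK //.
  by move: E1; rewrite /vec /=; lra.
- rewrite comb; apply: (mulIf S1); rewrite divfK //.
  by move: E2; rewrite /vec /=; lra.
Qed.

(** The three orientations are, up to scaling, the barycentric coordinates of [p w]; the strict one
    makes their sum positive. *)
Lemma convex_position_not_in_triangle (x y z w : 'I_n) :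
  w != x -> w != y -> w != z ->
  0 <= orient (p x) (p y) (p w) -> 0 <= orient (p y) (p z) (p w) ->
  0 < orient (p z) (p x) (p w) -> False.
Proof.
move=> wx wy wz Oxy Oyz Ozx.
apply: (@convex_position_no_combination x y z w _ _ _ wx wy wz
  Oyz (ltW Ozx) Oxy).
- by lra.
- by rewrite /orient /cross /vec /=; ring.
- by rewrite /orient /cross /vec /=; ring.
Qed.

Lemma convex_position_no_collinear (x y z : 'I_n) :
  x != y -> x != z -> y != z ->
  lexpos (vec (p x) (p y)) -> lexpos (vec (p x) (p z)) ->
  orient (p x) (p y) (p z) != 0.
Proof.
(* By symmetry [y] may be taken as the nearer point, so that it lies on the segment from [x] to [z].
   If both comparisons failed, the squared distance of [y] and [z] would be negative. *)
wlog yz_le : y z / dot (vec (p x) (p y)) (vec (p x) (p z)) <=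
                   dot (vec (p x) (p z)) (vec (p x) (p z)).
  move=> H xy xz yz Ly Lz.
  have [le|gt] := lerP (dot (vec (p x) (p y)) (vec (p x) (p z)))
                   (dot (vec (p x) (p z)) (vec (p x) (p z))).
    exact: H.
  have : orient (p x) (p z) (p y) != 0.
    apply: H => //; last by rewrite eq_sym.
    move: gt; rewrite /dot /vec /=.
    move: (p x) (p y) (p z) => [x1 x2] [y1 y2] [z1 z2] /= gt.
    rewrite leNgt; apply/negP => lt.
    by have := sqr_ge0 (y1 - z1); have := sqr_ge0 (y2 - z2); nra.
  by rewrite /orient /cross -oppr_eq0 opprB [X in X - _]mulrC
    [X in _ - X]mulrC.
move=> xy xz yz Ly Lz; apply/negP => /eqP O0.
have d0 := lexpos_parallel_dot_ge0 Ly Lz O0.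
have zz : 0 < dot (vec (p x) (p z)) (vec (p x) (p z)).
  by move/lexposP: Lz; rewrite /dot => -[|[-> ]] *; nra.
(* With [t] the position of [y] along the segment, these are the weights [1 - t] and [t] cleared of
   their denominator; the repeated [z] gets weight 0. *)
apply: (@convex_position_no_combination x z z y
  (dot (vec (p x) (p z)) (vec (p x) (p z))
   - dot (vec (p x) (p y)) (vec (p x) (p z)))
  (dot (vec (p x) (p y)) (vec (p x) (p z))) 0) => //.
- by rewrite eq_sym.
- by rewrite subr_ge0.
- by rewrite subrK addr0.
- move: O0; rewrite /orient /cross /dot /vec /=.
  move: (p x) (p y) (p z) => [x1 x2] [y1 y2] [z1 z2] /= O0.
  transitivity (((y1 - x1) * (z2 - x2) - (y2 - x2) * (z1 - x1)) * (x2 - z2)).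
    by ring.
  by rewrite O0 mul0r.
- move: O0; rewrite /orient /cross /dot /vec /=.
  move: (p x) (p y) (p z) => [x1 x2] [y1 y2] [z1 z2] /= O0.
  transitivity (((y1 - x1) * (z2 - x2) - (y2 - x2) * (z1 - x1)) * (z1 - x1)).
    by ring.
  by rewrite O0 mul0r.
Qed.

End ConvexPosition.

(** * Labelling points in convex position counterclockwise *)

Section CcwOrder.
Variable R : realType.

Lemma orient_rot (a b c : R * R) : orient b c a = orient a b c.
Proof. by rewrite /orient /cross /vec /=; ring. Qed.

Lemma orientC (a b c : R * R) : orient a c b = - orient a b c.
Proof. by rewrite /orient /cross /vec /=; ring. Qed.

Lemma sorting_exists (n : nat) (le : rel 'I_n) : total le -> transitive le ->
  exists2 s : 'I_n -> 'I_n, injective s &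
    forall i j : 'I_n, (i < j)%N -> le (s i) (s j).
Proof.
case: n le => [|n] le le_total le_trans.
  by exists id => // -[].
pose t := sort le (enum 'I_n.+1).
have sz : size t = n.+1 by rewrite size_sort size_enum_ord.
exists (fun i => nth ord0 t i) => [i j /eqP|i j ij].
  by rewrite nth_uniq ?sz ?sort_uniq ?enum_uniq // => /eqP/val_inj.
by apply: (sorted_ltn_nth le_trans) => //; rewrite ?sort_sorted ?inE ?sz.
Qed.

Lemma lex_min_exists (n : nat) (p : 'I_n -> R * R) : (0 < n)%N ->
  injective p -> exists l, forall i, i != l -> lexpos (vec (p l) (p i)).
Proof.
case: n p => // n p _ p_inj.
case: (@arg_minP _ _ _ ord0 xpredT (fun i => (p i).1)) => // k _ kP.
case: (@arg_minP _ _ _ k (fun i => (p i).1 == (p k).1) (fun i => (p i).2)) => //.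
move=> l /eqP lk lP; exists l => i il.
have := kP i isT; rewrite /lexpos /vec /= subr_gt0 subr_gt0 subr_eq0 lk.
rewrite [_ <= _]le_eqVlt => /orP[/eqP ki|->//].
rewrite ki ltxx eqxx /= lt_neqAle lP ?ki // andbT.
apply: contraNneq il => E; apply/eqP/p_inj.
by rewrite (surjective_pairing (p i)) (surjective_pairing (p l)) E lk ki.
Qed.

Lemma lex_max_exists (n : nat) (p : 'I_n -> R * R) : (0 < n)%N ->
  injective p -> exists l, forall i, i != l -> lexpos (vec (p i) (p l)).
Proof.
move=> n_gt0 p_inj.
have [|l lP] := @lex_min_exists n (fun i => (- (p i).1, - (p i).2)) n_gt0.
  move=> i j [/oppr_inj E1 /oppr_inj E2]; apply: p_inj.
  by rewrite (surjective_pairing (p i)) (surjective_pairing (p j)) E1 E2.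
exists l => i /lP; rewrite /lexpos /vec /=.
by rewrite !opprK ![- _ + _]addrC.
Qed.

(** The points are sorted by angle around the lexicographically least one, [l]. For the other
    points, a triple that fails to turn left would put its middle point into the triangle spanned by
    [l] and the two outer ones. *)
Lemma convex_position_ccw_order (n : nat) (p : 'I_n -> R * R) (o : 'I_n) :
  val o = 0%N -> injective p -> convex_position p ->
  exists s : 'I_n -> 'I_n, [/\ injective s,
    forall i j k : 'I_n, (i < j)%N -> (j < k)%N ->
      0 < orient (p (s i)) (p (s j)) (p (s k)) &
    forall i, i != o -> lexpos (vec (p (s o)) (p (s i)))].
Proof.
move=> o0 p_inj p_conv.
have [|l lP] := @lex_min_exists n p _ p_inj.
  exact: leq_ltn_trans (leq0n _) (ltn_ord o).
(* The first disjunct puts [l] at the front; the second is transitive because all directions leaving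
   [l] are in the half-plane. *)
pose le a b := (a == l) || (b != l) && (0 <= orient (p l) (p a) (p b)).
have le_total : total le.
  move=> a b; rewrite /le; case: eqVneq => //= al; case: eqVneq => //= bl.
  by rewrite (orientC _ (p a)) oppr_ge0 le_total.
have le_trans : transitive le.
  move=> b a c; rewrite /le; case: eqVneq => //= al.
  case: eqVneq => //= bl ab /andP[cl bc]; rewrite cl /=.
  by apply: cross_trans ab bc; apply: lP.
have [s s_inj s_le] := sorting_exists le_total le_trans.
have so : s o = l.
  have [t _ sK] : bijective s by exact: injF_bij.
  case: (eqVneq (t l) o) => [<-//|tl].
  have : (o < t l)%N by rewrite o0 lt0n -o0.
  by move/s_le; rewrite sK /le eqxx orbF => /eqP.
have s_neq (i : 'I_n) : (o < i)%N -> s i != l.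
  by move=> oi; rewrite -so (inj_eq s_inj) -val_eqE /= gtn_eqF.
have s_orient (i j : 'I_n) : (o < i)%N -> (i < j)%N ->
    0 < orient (p l) (p (s i)) (p (s j)).
  move=> oi ij; have oj := ltn_trans oi ij.
  rewrite lt_neqAle; apply/andP; split; last first.
    by have := s_le _ _ ij; rewrite /le (negPf (s_neq _ oi)) => /andP[].
  rewrite eq_sym; apply: convex_position_no_collinear => //.
  - by rewrite eq_sym s_neq.
  - by rewrite eq_sym s_neq.
  - by rewrite (inj_eq s_inj) -val_eqE /= ltn_eqF.
  - by rewrite lP ?s_neq.
  - by rewrite lP ?s_neq.
exists s; split => //.
- move=> i j k ij jk.
  have := leq0n i; rewrite -{1}o0 leq_eqVlt => /orP[/eqP/val_inj oi|oi].
    by rewrite -oi so s_orient // oi.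
  have oj := ltn_trans oi ij.
  rewrite ltNge; apply/negP => O.
  apply: (@convex_position_not_in_triangle R n p p_conv l (s i) (s k) (s j)).
  + exact: s_neq.
  + by rewrite (inj_eq s_inj) -val_eqE /= gtn_eqF.
  + by rewrite (inj_eq s_inj) -val_eqE /= ltn_eqF.
  + by rewrite ltW // s_orient.
  + by rewrite orientC oppr_ge0.
  + by rewrite -orient_rot s_orient.
- by move=> i io; rewrite so lP // -so (inj_eq s_inj).
Qed.

End CcwOrder.

(** * Counting pairs without a forbidden configuration *)

Definition npairs (T : finType) (r : rel T) (X Y : {set T}) : nat :=
  #|[set e : T * T | [&& e.1 \in X, e.2 \in Y & r e.1 e.2]]|.

Section PairCounting.
Variables (T : finType) (r : rel T).
Implicit Types X Y : {set T}.

Lemma npairsUl X1 X2 Y :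
  (npairs r (X1 :|: X2) Y <= npairs r X1 Y + npairs r X2 Y)%N.
Proof.
apply: leq_trans (leq_card_setU _ _); apply: subset_leq_card.
by apply/fintype.subsetP => e; rewrite !inE; case/and3P => /orP[] -> -> ->; rewrite ?orbT.
Qed.

Lemma npairsUr X Y1 Y2 :
  (npairs r X (Y1 :|: Y2) <= npairs r X Y1 + npairs r X Y2)%N.
Proof.
apply: leq_trans (leq_card_setU _ _); apply: subset_leq_card.
apply/fintype.subsetP => e; rewrite !inE.
by case/and3P => -> /orP[] -> ->; rewrite ?orbT.
Qed.

(* Every pair (b, c) is the f-largest in its column or the g-largest in its
   row. *)
Lemma npairs_linear X Y (f g : T -> nat) : injective f -> injective g ->
  (forall b a c d, b \in X -> a \in X -> c \in Y -> d \in Y ->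
     (f b < f a)%N -> (g c < g d)%N -> r b c -> r a c -> r b d -> False) ->
  (npairs r X Y <= #|X| + #|Y|)%N.
Proof.
move=> f_inj g_inj H.
pose E := [set e : T * T | [&& e.1 \in X, e.2 \in Y & r e.1 e.2]].
pose E1 := [set e in E | [forall a, (a \in X) && r a e.2 ==> (f a <= f e.1)%N]].
pose E2 := [set e in E | [forall d, (d \in Y) && r e.1 d ==> (g d <= g e.2)%N]].
have sE : E \subset E2 :|: E1.
  apply/fintype.subsetP => -[b c] bcE; rewrite inE [in X in X || _]inE [in X in _ || X]inE bcE /=.
  apply: contraT; rewrite negb_or !negb_forall.
  move: bcE; rewrite inE /= => /and3P[bX cY bc].
  case/andP => /existsP[d]; rewrite negb_imply -ltnNge => /andP[/andP[dY bd] cd].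
  case/existsP => [a]; rewrite negb_imply -ltnNge => /andP[/andP[aX ac] ba].
  by case: (H b a c d).
apply: leq_trans (subset_leq_card sE) _.
apply: leq_trans (leq_card_setU _ _) _; apply: leq_add.
(* Since [g] is injective, a row has only one [g]-largest pair, so [E2] injects into [X]; likewise
   [E1] injects into [Y]. *)
- have i1 : {in E2 &, injective (@fst T T)}.
    move=> [b c] [b' c']; rewrite !inE /=.
    move=> /andP[/and3P[bX cY bc] /forallP H1].
    move=> /andP[/and3P[bX' cY' bc'] /forallP H2] E0; subst b'.
    congr (_, _); apply: g_inj; apply/eqP; rewrite eqn_leq.
    by have := H1 c'; have := H2 c; rewrite cY cY' bc bc' /= => -> ->.
  rewrite -(card_in_imset i1); apply: subset_leq_card; apply/fintype.subsetP => x.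
  by case/imsetP => -[b c]; rewrite !inE => /andP[/and3P[/= bX _ _] _] ->.
- have i2 : {in E1 &, injective (@snd T T)}.
    move=> [b c] [b' c']; rewrite !inE /=.
    move=> /andP[/and3P[bX cY bc] /forallP H1].
    move=> /andP[/and3P[bX' cY' bc'] /forallP H2] E0; subst c'.
    congr (_, _); apply: f_inj; apply/eqP; rewrite eqn_leq.
    by have := H1 b'; have := H2 b; rewrite bX bX' bc bc' /= => -> ->.
  rewrite -(card_in_imset i2); apply: subset_leq_card; apply/fintype.subsetP => x.
  by case/imsetP => -[b c]; rewrite !inE => /andP[/and3P[_ /= cY _] _] ->.
Qed.

End PairCounting.

(** * The two chains of a counterclockwise polygon, from [o] to [m] and back *)

Section CcwPolygon.
Variables (R : realType) (n : nat) (q : 'I_n -> R * R) (o m : 'I_n).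
Hypothesis o0 : val o = 0%N.
Hypothesis mo : m != o.
Hypothesis q_orient : forall i j k : 'I_n,
  (i < j)%N -> (j < k)%N -> 0 < orient (q i) (q j) (q k).
Hypothesis q_min : forall i, i != o -> lexpos (vec (q o) (q i)).
Hypothesis q_max : forall i, i != m -> lexpos (vec (q i) (q m)).
Hypothesis q_inj : injective q.

Let o_lt (i : 'I_n) : i != o -> (o < i)%N.
Proof. by rewrite -val_eqE /= o0 lt0n. Qed.

Let neq_ord (i j : 'I_n) : (i < j)%N || (j < i)%N -> i != j.
Proof. by rewrite -neq_ltn. Qed.

(** If [q j] came before [q i], the directions [ji], [oj], [jm] would lie in the half-plane and turn
    left in this order. Then [j], [i], [m] would be counterclockwise, against [i < j < m]. *)
Lemma lower_chain_lexpos (i j : 'I_n) :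
  (i < j)%N -> (j <= m)%N -> lexpos (vec (q i) (q j)).
Proof.
move=> ij; rewrite leq_eqVlt => /orP[/eqP/val_inj jm|jm].
  by subst j; apply: q_max; rewrite neq_ord ?ij.
have [->|io] := eqVneq i o; first by apply: q_min; rewrite -val_eqE /= o0; lia.
have io' := o_lt io.
have qij : q i != q j by rewrite (inj_eq q_inj) neq_ord ?ij.
have /orP[//|ji] := lexpos_total qij.
have jo : j != o by rewrite -val_eqE /= o0; lia.
have := @cross_trans_lt R (vec (q o) (q j)) (vec (q j) (q i)) (vec (q j) (q m))
  ji (q_min jo) (q_max _).
rewrite neq_ord ?jm // => /(_ isT).
have := q_orient io' ij; have := q_orient (o_lt jo) jm; have := q_orient ij jm.
rewrite /orient /cross /vec /= => H1 H2 H3 H4.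
have := H4 _ _; lra.
Qed.

(** Same argument with the directions [ij], [jm], [oj], contradicting the orientation of [o], [i],
    [j]. *)
Lemma upper_chain_lexpos (i j : 'I_n) :
  (m <= i)%N -> (i < j)%N -> lexpos (vec (q j) (q i)).
Proof.
rewrite leq_eqVlt => /orP[/eqP/val_inj im|mi] ij.
  by subst i; apply: q_max; rewrite neq_ord ?ij ?orbT.
have qij : q i != q j by rewrite (inj_eq q_inj) neq_ord ?ij.
have /orP[ij'|//] := lexpos_total qij.
have om := o_lt mo.
have mj := ltn_trans mi ij.
have jo : j != o by rewrite -val_eqE /= o0; lia.
have := @cross_trans_lt R (vec (q j) (q m)) (vec (q i) (q j)) (vec (q o) (q j))
  ij' (q_max _) (q_min jo).
rewrite neq_ord ?mj ?orbT // => /(_ isT).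
have := q_orient mi ij; have := q_orient om mj.
have := q_orient (ltn_trans om mi) ij.
rewrite /orient /cross /vec /= => H1 H2 H3 H4.
have := H4 _ _; lra.
Qed.

Lemma ordS_spec (i : 'I_n) :
  (val (ordS i) = i.+1) \/ (ordS i = o /\ i.+1 = n).
Proof.
have := ltn_ord i; rewrite leq_eqVlt => /orP[/eqP E|lt]; [right|left].
  by split => //; apply: val_inj; rewrite /= E modnn o0.
by rewrite /= modn_small.
Qed.

(* Direction of the polygon side leaving i, reversed on the upper chain. *)
Definition side (i : 'I_n) : R * R :=
  if (i < m)%N then vec (q i) (q (ordS i)) else vec (q (ordS i)) (q i).

Lemma side_lexpos i : lexpos (side i).
Proof.
rewrite /side; case: ltnP => im; have [E|[E ni]] := ordS_spec i.
- by apply: lower_chain_lexpos; rewrite E.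
- by have := ltn_ord m; lia.
- by apply: upper_chain_lexpos => //; rewrite E.
- by rewrite E; apply: q_min; have := o_lt mo; rewrite -val_eqE /=; lia.
Qed.

(** By convexity a chord is, in direction, between the sides leaving its two ends. This lemma and
    the next three let the order of sides decide the order of chords. *)
Lemma lower_chord_le_side (i j : 'I_n) : (i < j)%N -> (j < m)%N ->
  0 <= cross (vec (q i) (q j)) (side j).
Proof.
move=> ij jm; rewrite /side jm; have [E|[E ni]] := ordS_spec j; last first.
  by have := ltn_ord m; lia.
have := q_orient ij (_ : (j < ordS j)%N); rewrite {1}E => /(_ (leqnn _)).
by rewrite /orient /cross /vec /=; lra.
Qed.

Lemma lower_side_le_chord (i j : 'I_n) : (i < j)%N -> (j < m)%N ->
  0 <= cross (side i) (vec (q i) (q j)).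
Proof.
move=> ij jm; rewrite /side (ltn_trans ij jm).
have [E|[E ni]] := ordS_spec i; last by have := ltn_ord m; lia.
have [<-|ji] := eqVneq (ordS i) j; first by rewrite /cross; lra.
have := @q_orient i (ordS i) j; rewrite E => /(_ (leqnn _)) H.
by apply/ltW/H; move: ji; rewrite -val_eqE E /=; lia.
Qed.

Lemma upper_chord_le_side (i j : 'I_n) : (m <= i)%N -> (i < j)%N ->
  0 <= cross (vec (q j) (q i)) (side j).
Proof.
move=> mi ij; rewrite /side ltnNge (leq_trans mi (ltnW ij)) /=.
have [E|[-> nj]] := ordS_spec j.
  have := q_orient ij (_ : (j < ordS j)%N); rewrite {1}E => /(_ (leqnn _)).
  by rewrite /orient /cross /vec /=; lra.
(* Here [j] is the last vertex and its side closes up at [o], so the triangle [o], [i], [j] is the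
   relevant one. *)
have := q_orient (leq_trans (o_lt mo) mi) ij.
by rewrite /orient /cross /vec /=; lra.
Qed.

Lemma upper_side_le_chord (i j : 'I_n) : (m <= i)%N -> (i < j)%N ->
  0 <= cross (side i) (vec (q j) (q i)).
Proof.
move=> mi ij; rewrite /side ltnNge mi /=.
have [E|[E ni]] := ordS_spec i; last by have := ltn_ord j; lia.
have [<-|ji] := eqVneq (ordS i) j; first by rewrite /cross; lra.
have := @q_orient i (ordS i) j; rewrite E => /(_ (leqnn _)) H.
have {H} := H _; rewrite /orient /cross /vec /= => H.
suff : (i.+1 < j)%N by move/H; lra.
by move: ji; rewrite -val_eqE E /=; lia.
Qed.

(** * Nested edges of a locally Gabriel graph *)

Variable adj : rel 'I_n.
Hypothesis adj_simple : simple_graph adj.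
Hypothesis adj_gabriel : locally_gabriel q adj.

Lemma gabriel_acute (u v w : 'I_n) : adj u v -> adj u w -> w != v ->
  0 < dot (vec (q w) (q u)) (vec (q w) (q v)).
Proof.
move=> uv uw wv; have [_ irr] := adj_simple.
have wu : w != u by apply: contraTneq uw => ->.
have := adj_gabriel uv wu wv; rewrite uw => /(_ isT).
by rewrite in_diam_diskE -ltNge.
Qed.

(** The angles at [b] in [abc] and at [c] in [bcd] are acute, so [ba] and [cd], on the same side of
    [bc], lean towards each other. The cross product is then negative. *)
Lemma no_nested_widening (b a d c : 'I_n) :
  (b < a)%N -> (a < d)%N -> (d < c)%N -> adj b c -> adj a c -> adj b d ->
  0 <= cross (vec (q b) (q a)) (vec (q c) (q d)) -> False.
Proof.
move=> ba ad dc bc ac bd; have [sym _] := adj_simple.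
have H1 : 0 < dot (vec (q b) (q c)) (vec (q b) (q a)).
  by apply: gabriel_acute; [rewrite sym|rewrite sym|rewrite neq_ord //; lia].
have H2 : 0 < dot (vec (q c) (q b)) (vec (q c) (q d)).
  by apply: gabriel_acute; [|done|rewrite neq_ord //; lia].
have O1 := q_orient ba (ltn_trans ad dc).
have O2 := q_orient (ltn_trans ba ad) dc.
apply/negP; rewrite -ltNge.
apply: (@acute_cw_cross_lt0 R _ _ (vec (q b) (q c))) => //;
  by move: H1 H2 O1 O2; rewrite /orient /cross /dot /vec /=; lra.
Qed.

(** The mirror case: [a] and [d] are now on the other side of [bc], which flips the sign. *)
Lemma no_nested_narrowing (a b c d : 'I_n) :
  (a < b)%N -> (b < c)%N -> (c < d)%N -> adj b c -> adj a c -> adj b d ->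
  0 <= cross (vec (q d) (q c)) (vec (q a) (q b)) -> False.
Proof.
move=> ab bc' cd bc ac bd; have [sym _] := adj_simple.
have H1 : 0 < dot (vec (q b) (q c)) (vec (q b) (q a)).
  by apply: gabriel_acute; [rewrite sym|rewrite sym|rewrite neq_ord //; lia].
have H2 : 0 < dot (vec (q c) (q b)) (vec (q c) (q d)).
  by apply: gabriel_acute; [|done|rewrite neq_ord //; lia].
have O1 := q_orient ab bc'.
have O2 := q_orient bc' cd.
have : 0 < cross (vec (q b) (q a)) (vec (q c) (q d)).
  apply: (@acute_ccw_cross_gt0 R _ _ (vec (q b) (q c))) => //;
    by move: H1 H2 O1 O2; rewrite /orient /cross /dot /vec /=; lra.
by rewrite /cross /vec /=; lra.
Qed.

(** * Counting edges inside and between the chains *)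

Let r : rel 'I_n := fun i j => (i < j)%N && adj i j.

Definition lower : {set 'I_n} := [set i : 'I_n | (i < m)%N].

Definition upper : {set 'I_n} := [set i : 'I_n | (m <= i)%N].

Let rev_inj : injective (fun i : 'I_n => (n - i)%N).
Proof.
move=> i j E; apply: val_inj; have := ltn_ord i; have := ltn_ord j.
by move: E => /=; lia.
Qed.

(** Acute angles at [b] and [c] would make the path [abcd] turn left by more than a half-turn in
    total, but the directions of a chain stay in a half-plane. *)
Lemma npairs_lower : (npairs r lower lower <= #|lower| + #|lower|)%N.
Proof.
(* The key [n - i] reverses the order, so the excluded configuration has [a < b] and [c < d]. *)
apply: (npairs_linear rev_inj val_inj) => b a c d; rewrite !inE.
move=> bm am cm dm fba cd /andP[bc' bc] /andP[_ ac] /andP[_ bd].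
have ab : (a < b)%N by have := ltn_ord b; have := ltn_ord a; lia.
apply: (no_nested_narrowing ab bc' cd bc ac bd).
have L1 := lower_chain_lexpos ab (ltnW bm).
have L2 := lower_chain_lexpos bc' (ltnW cm).
have L3 := lower_chain_lexpos cd (ltnW dm).
have := @cross_trans R _ _ _ L1 L2 L3.
have := q_orient ab bc'; have := q_orient bc' cd.
rewrite /orient /cross /vec /= => H1 H2 H; have {}H := H _ _.
by have := H _ _; lra.
Qed.

Lemma npairs_upper : (npairs r upper upper <= #|upper| + #|upper|)%N.
Proof.
apply: (npairs_linear rev_inj val_inj) => b a c d; rewrite !inE.
move=> bm am cm dm fba cd /andP[bc' bc] /andP[_ ac] /andP[_ bd].
have ab : (a < b)%N by have := ltn_ord b; have := ltn_ord a; lia.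
apply: (no_nested_narrowing ab bc' cd bc ac bd).
have L1 := upper_chain_lexpos am ab.
have L2 := upper_chain_lexpos bm bc'.
have L3 := upper_chain_lexpos cm cd.
have := @cross_trans R _ _ _ L1 L2 L3.
have := q_orient ab bc'; have := q_orient bc' cd.
rewrite /orient /cross /vec /= => H1 H2 H; have {}H := H _ _.
by have := H _ _; lra.
Qed.

Lemma npairs_widening (X Y : {set 'I_n}) :
  (forall i j, i \in X -> j \in Y -> 0 <= cross (side i) (side j)) ->
  (npairs r (lower :&: X) (upper :&: Y)
     <= #|lower :&: X| + #|upper :&: Y|)%N.
Proof.
move=> XY; apply: (npairs_linear val_inj rev_inj) => b a c d; rewrite !inE.
move=> /andP[bm bX] /andP[am aX] /andP[cm cY] /andP[dm dY] ba fcd.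
move=> /andP[bc' bc] /andP[_ ac] /andP[_ bd].
have dc : (d < c)%N by have := ltn_ord c; have := ltn_ord d; lia.
apply: (no_nested_widening ba (leq_trans am dm) dc bc ac bd).
have Lba := lower_chain_lexpos ba (ltnW am).
have Ldc := upper_chain_lexpos dm dc.
(* The directions are compared along [ba], [side a], [side d], [cd]; the middle comparison is the
   hypothesis on [X] and [Y]. *)
apply: (cross_trans Lba (side_lexpos a) Ldc (lower_chord_le_side ba am)).
apply: (cross_trans (side_lexpos a) (side_lexpos d) Ldc (XY _ _ aX dY)).
exact: upper_side_le_chord.
Qed.

Lemma npairs_narrowing (X Y : {set 'I_n}) :
  (forall i j, i \in X -> j \in Y -> 0 <= cross (side i) (side j)) ->
  (npairs r (lower :&: Y) (upper :&: X)
     <= #|lower :&: Y| + #|upper :&: X|)%N.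
Proof.
move=> XY; apply: (npairs_linear rev_inj val_inj) => b a c d; rewrite !inE.
move=> /andP[bm bY] /andP[am aY] /andP[cm cX] /andP[dm dX] fba cd.
move=> /andP[bc' bc] /andP[_ ac] /andP[_ bd].
have ab : (a < b)%N by have := ltn_ord b; have := ltn_ord a; lia.
apply: (no_nested_narrowing ab (leq_trans bm cm) cd bc ac bd).
have Lab := lower_chain_lexpos ab (ltnW bm).
have Lcd := upper_chain_lexpos cm cd.
(* Here the comparison runs along [dc], [side d], [side a], [ab]. *)
apply: (cross_trans Lcd (side_lexpos d) Lab (upper_chord_le_side cm cd)).
apply: (cross_trans (side_lexpos d) (side_lexpos a) Lab (XY _ _ dX aY)).
exact: lower_side_le_chord.
Qed.

Lemma card_chains (S : {set 'I_n}) :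
  (#|lower :&: S| + #|upper :&: S| = #|S|)%N.
Proof.
rewrite -(cardsID lower S) finset.setIC; congr (_ + #|pred_of_set _|)%N.
by apply/finset.setP => i; rewrite !inE -leqNgt.
Qed.

Lemma npairs_lower_upper (k : nat) :
  (n <= 2 ^ k)%N -> (npairs r lower upper <= k * n)%N.
Proof.
pose le i j := 0 <= cross (side i) (side j).
have le_total : total le.
  move=> i j; rewrite /le (_ : cross (side j) (side i) = - cross (side i) (side j)).
    by rewrite oppr_ge0 le_total.
  by rewrite /cross; ring.
have le_trans : transitive le.
  by move=> j i l; apply: cross_trans; apply: side_lexpos.
have [s s_inj s_le] := sorting_exists le_total le_trans.
have [rk sK rkK] : bijective s by exact: injF_bij.
pose S lo h := [set i | lo <= rk i < lo + h]%N.
(* Induction over windows of consecutive ranks in the order of side directions. A window may reach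
   beyond rank [n], so [n] need not be a power of two. *)
have rec : forall lo, (npairs r (lower :&: S lo (2 ^ k)) (upper :&: S lo (2 ^ k))
                 <= k * #|S lo (2 ^ k)|)%N.
  elim: k => [|k IH] lo.
    (* A window of width 1 has at most one vertex, which cannot be on both chains. *)
    rewrite leqn0 cards_eq0; apply/eqP/finset.setP => -[i j]; rewrite !inE /=.
    apply/negP => /and3P[/andP[im ilo] /andP[jm jlo] _].
    have /val_inj E : val (rk i) = val (rk j) by rewrite /=; lia.
    by have := can_inj rkK E => {}E; subst j; lia.
  pose X := S lo (2 ^ k)%N; pose Y := S (lo + 2 ^ k)%N (2 ^ k)%N.
  have SXY : S lo (2 ^ k.+1)%N = X :|: Y.
    by apply/finset.setP => i; rewrite !inE expnS; lia.
  have XY i j : i \in X -> j \in Y -> 0 <= cross (side i) (side j).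
    rewrite !inE => iX jY; rewrite -(rkK i) -(rkK j); apply: s_le; lia.
  have cS : #|S lo (2 ^ k.+1)%N| = (#|X| + #|Y|)%N.
    rewrite SXY cardsU (_ : X :&: Y = finset.set0) ?cards0 ?subn0 //.
    by apply/finset.setP => i; rewrite !inE; lia.
  rewrite cS SXY !finset.setIUr.
  have U1 := npairsUl r (lower :&: X) (lower :&: Y)
               ((upper :&: X) :|: (upper :&: Y)).
  have U2 := npairsUr r (lower :&: X) (upper :&: X) (upper :&: Y).
  have U3 := npairsUr r (lower :&: Y) (upper :&: X) (upper :&: Y).
  (* The two mixed blocks cost [#|X| + #|Y|] together, the size of the window; this is the increment
     from [k] to [k.+1]. *)
  have W := npairs_widening XY; have N := npairs_narrowing XY.
  have cX := card_chains X; have cY := card_chains Y.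
  have BX := leq_trans U2 (leq_add (IH lo) W).
  have BY := leq_trans U3 (leq_add N (IH (lo + 2 ^ k)%N)).
  apply: leq_trans (leq_trans U1 (leq_add BX BY)) _.
  rewrite -/X -/Y mulnDr !mulSn -cX -cY.
  by move: (#|_ :&: _|) (#|_ :&: _|) (#|_ :&: _|) (#|_ :&: _|) => *; lia.
move=> nk; have := rec 0%N.
have -> : S 0%N (2 ^ k)%N = [set: 'I_n].
  by apply/finset.setP => i; rewrite !inE add0n /= (leq_trans (ltn_ord _)).
by rewrite !finset.setIT cardsT card_ord.
Qed.

Lemma num_edges_ccw_polygon (k : nat) :
  (n <= 2 ^ k)%N -> (num_edges adj <= k * n + 2 * n)%N.
Proof.
move=> nk.
have -> : num_edges adj = npairs r (lower :|: upper) (lower :|: upper).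
  apply: eq_card => -[i j]; rewrite !inE /=.
  by case: (ltnP i m); case: (ltnP j m).
have U1 := npairsUl r lower upper (lower :|: upper).
have U2 := npairsUr r lower lower upper.
have U3 := npairsUr r upper lower upper.
(* [r] lists each edge with its smaller index first, and lower indices precede upper ones. *)
have E : npairs r upper lower = 0%N.
  apply/eqP; rewrite cards_eq0; apply/eqP/finset.setP => -[i j].
  by rewrite !inE /r /=; apply/negP; lia.
have := card_chains [set: 'I_n]; rewrite !finset.setIT cardsT card_ord => cards_lu.
apply: leq_trans (leq_trans U1 (leq_add U2 U3)) _; rewrite E add0n.
apply: leq_trans (leq_add (leq_add npairs_lower (npairs_lower_upper nk))
  npairs_upper) _.
by rewrite mul2n -addnn -[in X in (_ <= _ + X)%N]cards_lu; lia.
Qed.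

End CcwPolygon.

(** * Invariance of the edge count under relabelling *)

Lemma num_edges_double (n : nat) (adj : rel 'I_n) : simple_graph adj ->
  (num_edges adj).*2 = #|[set e : 'I_n * 'I_n | adj e.1 e.2]|.
Proof.
move=> [sym irr]; rewrite /num_edges.
set E := [set e : 'I_n * 'I_n | adj e.1 e.2].
rewrite -(cardsID [set e : 'I_n * 'I_n | (e.1 < e.2)%N] E) -addnn.
congr (_ + _)%N; first by apply: eq_card => e; rewrite !inE andbC.
have swap_inj : injective (fun e : 'I_n * 'I_n => (e.2, e.1)).
  by move=> [a b] [c d] [-> ->].
rewrite -(card_imset _ swap_inj); apply: eq_card => -[a b].
apply/imsetP/idP => [[[c d]]|]; rewrite !inE /=.
  by move=> /andP[cd adj_cd] [-> ->]; rewrite sym adj_cd andbT -leqNgt ltnW.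
move=> /andP[ba adj_ab]; exists (b, a) => //; rewrite !inE /= sym adj_ab andbT.
rewrite ltn_neqAle leqNgt ba andbT; apply: contraTneq adj_ab => /val_inj ->.
exact: irr.
Qed.

(** [num_edges] refers to the order of the indices, which [s] need not respect; the number of
    ordered adjacent pairs, twice as large, does not. *)
Lemma num_edges_relabel (n : nat) (adj : rel 'I_n) (s : 'I_n -> 'I_n) :
  simple_graph adj -> injective s -> num_edges adj = num_edges (relpre s adj).
Proof.
move=> adj_simple s_inj; apply: double_inj; rewrite !num_edges_double //; last first.
  by case: adj_simple => sym irr; split=> *; [apply: sym | apply: irr].
have [t sK tK] : bijective s by exact: injF_bij.
have ss_inj : injective (fun e : 'I_n * 'I_n => (s e.1, s e.2)).
  by move=> [a b] [c d] [/s_inj -> /s_inj ->].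
rewrite -[RHS](card_imset _ ss_inj); apply: eq_card => -[a b].
rewrite !inE /=; apply/idP/imsetP => [ab|[[c d]]].
  by exists (t a, t b); rewrite ?inE /= !tK.
by rewrite inE /= => cd [-> ->].
Qed.

(** * The bound for point sets, and the passage to logarithms *)

Lemma num_edges_convex_gabriel (R : realType) (n k : nat) (p : 'I_n -> R * R)
    (adj : rel 'I_n) :
  injective p -> convex_position p -> simple_graph adj ->
  locally_gabriel p adj -> (n <= 2 ^ k)%N ->
  (num_edges adj <= k * n + 2 * n)%N.
Proof.
move=> p_inj p_conv adj_simple adj_gab nk.
(* The two extreme vertices [o] and [m] differ only when there are at least two points. *)
have [n_le1|n_gt1] := leqP n 1.
  rewrite (_ : num_edges adj = 0%N) //; apply/eqP; rewrite cards_eq0.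
  apply/eqP/finset.setP => -[a b]; rewrite !inE /=.
  by apply/negP => /andP[ab _]; have := ltn_ord b; lia.
pose o : 'I_n := Ordinal (ltnW n_gt1).
have [s [s_inj s_orient s_min]] :=
  convex_position_ccw_order (erefl : val o = 0%N) p_inj p_conv.
have q_inj : injective (p \o s) := inj_comp p_inj s_inj.
have [m m_max] := lex_max_exists (ltnW n_gt1) q_inj.
have mo : m != o.
  apply/eqP => mo; pose i : 'I_n := Ordinal n_gt1.
  have io : i != o by [].
  have := s_min i io; have := m_max i; rewrite mo => /(_ io).
  by move=> /lexpos_asym /negP.
rewrite (num_edges_relabel adj_simple s_inj).
apply: (num_edges_ccw_polygon (erefl : val o = 0%N) mo s_orient s_min m_max q_inj) => //.
  by case: adj_simple => sym irr; split=> *; [apply: sym | apply: irr].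
move=> u v uv w wu wv; by apply: adj_gab => //; rewrite (inj_eq s_inj).
Qed.

Theorem theorem3 :
  exists C : nat, forall (R : realType) (n : nat) (p : 'I_n -> R * R)
    (adj : rel 'I_n),
    injective p -> convex_position p -> simple_graph adj ->
    locally_gabriel p adj ->
    (num_edges adj)%:R <= 2 * n%:R * log2 (n%:R : R) + C%:R * n%:R.
Proof.
(* With [k] the rounded-up logarithm, [k <= log n + 1] turns [(k + 2) n] into [n log n + 3 n]. As
   [log n >= 0] for [n >= 1], the stated leading factor 2 leaves room. *)
exists 3%N => R n p adj p_inj p_conv adj_simple adj_gab.
have := num_edges_convex_gabriel p_inj p_conv adj_simple adj_gab
  (up_logP n (ltnSn 1)).
set k := up_log 2 n => E_le.
have [n0|n_gt0] := posnP n.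
  have -> : num_edges adj = 0%N.
    by apply/eqP; rewrite -leqn0 (leq_trans E_le) // n0 !muln0.
  have -> : n%:R = 0 :> R by rewrite n0.
  by rewrite !mulr0 mul0r addr0.
have ln2_gt0 : 0 < ln (2 : R) by rewrite ln_gt0 // ltr1n.
have log_ge0 : 0 <= log2 (n%:R : R).
  by rewrite divr_ge0 ?ln_ge0 ?ler1n // ltW.
have k_le : k%:R <= log2 (n%:R : R) + 1.
  have [n_le1|n_gt1] := leqP n 1.
    have -> : k = 0%N by apply/eqP; rewrite up_log_eq0 n_le1.
    by rewrite addr_ge0.
  have /andP[lt_n _] := up_log_bounds (ltnSn 1) n_gt1.
  have k_gt0 : (0 < k)%N by rewrite up_log_gt0.
  (* Minimality of [k] gives [2 ^ k.-1 < n], hence [k - 1 <= log n]. *)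
  rewrite -(prednK k_gt0) -natr1 lerD2r ler_pdivlMr //.
  rewrite mulr_natl -lnXn ?ltr0n // ler_ln ?posrE ?exprn_gt0 ?ltr0n //.
  by rewrite -natrX ler_nat ltnW.
have : (num_edges adj)%:R <= (k%:R + 2) * n%:R :> R.
  by rewrite -natrD -natrM ler_nat mulnDl.
move/le_trans; apply; have : 0 <= n%:R :> R by rewrite ler0n.
by nra.
Qed.
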